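(* Let $\sigma=\{\pi_i\mid i\in I\}$ be a partition of the set $\mathbb{P}$ of all primes, let $G$ be a finite group, and let $\mathcal{M}$ be a set of subgroups of $G$ each of which is a maximal $\pi_i$-subgroup of $G$ for some $\pi_i\in\sigma$, such that (a) if $H\in\mathcal{M}$, then $H^x\in\mathcal{M}$ for every $x\in G$; (b) for every Sylow subgroup $P$ of $G$ there is $H\in\mathcal{M}$ with $P\leq H$. Then the intersection of the normalizers in $G$ of all subgroups from $\mathcal{M}$ is $\mathrm{Z}_{\mathfrak{N}_\sigma}(G)$.
   Context: All groups are finite. A maximal $\pi_i$-subgroup of $G$ is a $\pi_i$-subgroup of $G$ not properly contained in any other $\pi_i$-subgroup of $G$. A group $G$ is $\sigma$-nilpotent if it has a normal Hall $\pi_i$-subgroup for every $i\in I$ with $\pi(G)\cap\pi_i\neq\emptyset$, where $\pi(G)$ is the set of prime divisors of $|G|$; $\mathfrak{N}_\sigma$ is the class of all $\sigma$-nilpotent groups. For a class of groups $\mathfrak{X}$, a chief factor $H/K$ of $G$ is $\mathfrak{X}$-central in $G$ if $(H/K)\rtimes (G/C_G(H/K))\in\mathfrak{X}$ (action by conjugation). A normal subgroup $N$ of $G$ is $\mathfrak{X}$-hypercentral in $G$ if $N=1$, or $N\neq1$ and every chief factor of $G$ below $N$ is $\mathfrak{X}$-central in $G$. The $\mathfrak{X}$-hypercenter $\mathrm{Z}_{\mathfrak{X}}(G)$ is the product of all normal $\mathfrak{X}$-hypercentral subgroups of $G$. *)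

(* Defs.v *)
From HB Require Import structures.
From mathcomp Require Import all_boot all_fingroup all_solvable.
From mathcomp Require Import boolp.

Set Implicit Arguments.
Unset Strict Implicit.
Unset Printing Implicit Defensive.

Local Open Scope group_scope.

Definition prime_partition (I : Type) (pi : I -> nat_pred) : Prop :=
  [/\ forall i p, p \in pi i -> prime p,
      forall i, exists p, p \in pi i,
      forall p, prime p -> exists i, p \in pi i
    & forall i j p, p \in pi i -> p \in pi j -> i = j].

Definition group_class := forall gT : finGroupType, {group gT} -> Prop.

Definition sigma_nilpotent (I : Type) (pi : I -> nat_pred) : group_class :=
  fun gT G => forall i, (exists2 p, p \in \pi(G) & p \in pi i) ->
    exists2 H : {group gT}, H <| G & (pi i).-Hall(G) H.

(* 'Q is the conjugation action on cosets of K, so 'C_G(H / K | 'Q) is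
   C_G(H/K), and 'Q %% 'C_G(H / K | 'Q) is the induced action of the quotient
   by C_G(H/K); see chief_actionE. *)
Lemma chief_acts (gT : finGroupType) (G K H : {group gT}) :
  chief_factor G K H ->
  {acts G / 'C_G(H / K | 'Q), on group H / K | 'Q %% 'C_G(H / K | 'Q)}.
Proof.
case/andP=> /maxgroupp/andP[_ nKG] /andP[sHG nHG].
have actsG : [acts G, on H / K | 'Q] by exact: actsQ.
have actsC : 'C_G(H / K | 'Q) \subset 'C(H / K | 'Q) by exact: subsetIr.
have rHK : H / K \subset setT / K by rewrite quotientS ?subsetT.
have domC : 'C_G(H / K | 'Q) \subset qact_dom 'J K.
  by apply/subsetP=> x /(subsetP actsC)/astab_dom.
split; first by rewrite astabs_mod ?quotientS.
by rewrite gacentE // subsetI rHK -astabCin.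
Qed.

Definition chief_action (gT : finGroupType) (G K H : {group gT})
  (chHK : chief_factor G K H) :
    groupAction (G / 'C_G(H / K | 'Q)) (H / K) :=
  <[chief_acts chHK]>%gact.

Lemma chief_actionE (gT : finGroupType) (G K H : {group gT})
    (chHK : chief_factor G K H) (h g : gT) :
  h \in H -> g \in G ->
  chief_action chHK (coset K h) (coset 'C_G(H / K | 'Q) g) = coset K (h ^ g).
Proof.
move=> Hh Gg; have /andP[/maxgroupp/andP[_ nKG] /andP[sHG nHG]] := chHK.
have [nKh nKg] : h \in 'N(K) /\ g \in 'N(K).
  by split; apply: (subsetP nKG) => //; apply: (subsetP sHG).
have actsG : [acts G, on H / K | 'Q] by exact: actsQ.
have nCg : g \in 'N('C_G(H / K | 'Q)).
  apply: subsetP g Gg {nKg}.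
  by rewrite normsI ?normG // (subset_trans actsG) ?astab_norm.
have [_ sHC] := chief_acts chHK.
have /setIP[_ fixh] := subsetP sHC _ (mem_quotient K Hh).
rewrite actbyE ?mem_quotient //= modactE //=; last by rewrite dom_qactJ.
by rewrite qactJ nKg morphJ.
Qed.

Definition central_chief_factor (X : group_class) (gT : finGroupType)
    (G K H : {group gT}) (chHK : chief_factor G K H) : Prop :=
  X _ [set: sdprod_by (chief_action chHK)]%G.

Definition hypercentral (X : group_class) (gT : finGroupType)
    (G N : {group gT}) : Prop :=
  N :=: 1 \/ N :!=: 1 /\
    forall (K H : {group gT}) (chHK : chief_factor G K H),
      H \subset N -> central_chief_factor X chHK.

(* A product of subsets; the factors are normal in G, so their order is
   irrelevant. *)
Definition hypercenter (X : group_class) (gT : finGroupType)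
    (G : {group gT}) : {set gT} :=
  \prod_(N : {group gT} | `[< N <| G /\ hypercentral X G N >]) N.

(* Main.v *)
Require Import Defs.
From HB Require Import structures.
From mathcomp Require Import all_boot all_fingroup all_solvable.
From mathcomp Require Import boolp.

Set Implicit Arguments.
Unset Strict Implicit.
Unset Printing Implicit Defensive.

Local Open Scope group_scope.

(** A chief factor H/K of G is N_sigma-central exactly when, for some i, both H/K
    and G/C_G(H/K) are pi_i-groups.  Consequently a normal subgroup N is
    hypercentral iff it is the product of normal Hall pi_i-subgroups
    'O_(pi i)(N), each centralised by all pi_i'-subgroups of G; this
    series-free condition is called [sigma_central] below.  Going from the chief
    factors to N is an induction on a chief factor at the top of N, where the new
    Hall subgroup comes from a Schur-Zassenhaus complement and is centralised by a
    coprime action argument; going back, every chief factor below N is covered by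
    one of the 'O_(pi i)(N).

    The corollary then compares this condition with normalising the members of M.
    If N is [sigma_central] and H is a maximal pi_i-subgroup, then 'O_(pi i)(N)
    lies in H, as it is a normal pi_i-subgroup of G, whereas 'O_(pi j)(N) for
    j <> i is centralised by H; so N normalises H ([sigma_central_norm_max]).
    Conversely let D normalise every member of M.  A Sylow subgroup of D with prime
    in pi_i lies in some H in M, hence in the normal pi_i-subgroup H :&: D of D,
    hence in 'O_(pi i)(D); and a Sylow subgroup of G with prime outside pi_i lies
    in some pi_j-group H in M with j <> i, which meets 'O_(pi i)(D) trivially and
    normalises it while being normalised by it, so centralises it
    ([sigma_central_of_norm_max]). *)

(** * Hall subgroups, coprime commutators and products *)

(** If A contains a Hall subgroup of B for each prime dividing #|B|, then #|B|
    divides #|A :&: B| prime by prime.  Hall subgroups for varying prime sets are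
    allowed so that the 'O_(pi i) can serve as the E directly. *)
Lemma subG_Hall_cover (gT : finGroupType) (A B : {group gT}) :
  (forall p, p \in \pi(B) -> exists (rho : nat_pred) (E : {group gT}),
     [/\ p \in rho, rho.-Hall(B) E & E \subset A]) ->
  B \subset A.
Proof.
move=> cov; suff: #|B| %| #|A :&: B|.
  move/dvdn_leq=> /(_ (cardG_gt0 _)) leB.
  by apply/setIidPr/eqP; rewrite eqEcard subsetIr.
apply/dvdn_partP=> // p /cov[rho [E [rho_p hallE sEA]]].
have -> : (#|B|`_p)%N = (#|E|`_p)%N.
  by rewrite (card_Hall hallE) partn_part // => q /eqP->.
rewrite (dvdn_trans (dvdn_part _ _)) // cardSg // subsetI sEA.
exact: pHall_sub hallE.
Qed.

Lemma pgroup_quotient_p'sub (pi : nat_pred) (gT : finGroupType)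
    (G C : {group gT}) :
  G \subset 'N(C) ->
  (forall B : {group gT}, pi^'.-subgroup(G) B -> B \subset C) ->
  pi.-group (G / C).
Proof.
move=> nCG sC; apply/pgroupP=> p pr_p dv_p; apply/idPn=> pi'p.
have [P sylP] := Sylow_exists p G.
have /sC sPC : pi^'.-subgroup(G) P.
  rewrite /psubgroup (pHall_sub sylP); apply: sub_in_pnat (pHall_pgroup sylP).
  by move=> q _ /eqP->.
have /card_Hall := quotient_pHall (subset_trans (pHall_sub sylP) nCG) sylP.
rewrite /= (quotientS1 sPC) cards1 => /esym/eqP; rewrite p_part_eq1.
by rewrite mem_primes pr_p cardG_gt0 dv_p.
Qed.

(** If x fixes c = [~ t, x], then t ^ (x ^+ n) = t * c ^+ n; at n = #[x] this
    gives c ^+ #[x] = 1, so c = 1 by coprimality. *)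
Lemma coprime_commg_cent (gT : finGroupType) (t x : gT) :
  commute [~ t, x] x -> coprime #[[~ t, x]] #[x] -> commute t x.
Proof.
set c := [~ t, x] => cx co_cx.
have tXn n : t ^ (x ^+ n) = t * c ^+ n.
  elim: n => [|n IHn]; first by rewrite expg0 conjg1 mulg1.
  rewrite expgSr conjgM IHn conjMg conjg_mulR -/c -mulgA; congr (_ * _).
  have /conjg_fixP-> : [~ c ^+ n, x] == 1.
    by apply/commgP; exact/commute_sym/commuteX/commute_sym.
  by rewrite expgS.
apply/commgP; rewrite -/c -order_eq1 -dvdn1 -(eqnP co_cx) dvdn_gcd dvdnn.
rewrite order_dvdn; apply/eqP/(mulgI t).
by rewrite -tXn expg_order conjg1 mulg1.
Qed.

Lemma sub_prod_group (gT : finGroupType) (J : finType) (P : pred J)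
    (F : J -> {group gT}) j : P j -> F j \subset \prod_(i | P i) F i.
Proof.
move=> Pj; have: j \in index_enum J by rewrite mem_index_enum.
elim: (index_enum J) => // i r IHr.
rewrite inE big_cons => /predU1P[<- | /IHr sFj].
  rewrite Pj mulg_subl //; elim/big_ind: _ => [|A B A1 B1|k _] //.
  by rewrite -[1]mulg1 mem_mulg.
case: ifP => // _; exact: subset_trans sFj (mulG_subr (F i) _).
Qed.

(** * Central chief factors *)

Section SigmaCentral.

Variables (I : Type) (pi : I -> nat_pred).
Hypothesis pi_part : prime_partition pi.

Lemma pi_cover p : prime p -> exists i, p \in pi i.
Proof. by case: pi_part => _ _ + _; apply. Qed.

Lemma pi_inj i j p : p \in pi i -> p \in pi j -> i = j.
Proof. by case: pi_part => _ _ _; apply. Qed.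

Lemma pi'_nat i j n : i <> j -> (pi j).-nat n -> (pi i)^'.-nat n.
Proof.
move=> nij; apply: sub_in_pnat => q _ qj; apply/negP=> qi.
exact: nij (pi_inj qi qj).
Qed.

(** The Sylow subgroups of X lie in normal Hall pi_j-subgroups with j <> i, and
    such a subgroup commutes with E, both being normal with coprime orders. *)
Lemma sigma_nilpotent_cent (gT : finGroupType) (L E X : {group gT}) i :
  sigma_nilpotent pi L -> (pi i).-Hall(L) E -> E <| L ->
  (pi i)^'.-subgroup(L) X -> X \subset 'C(E).
Proof.
move=> nilL hallE nEL /andP[sXL pi'X]; apply: subG_Hall_cover => p pX.
have pr_p : prime p by move: pX; rewrite mem_primes => /andP[].
have [j pj] := pi_cover pr_p.
have pi'p : p \notin pi i by have := pnatPpi pi'X pX.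
have [|F nFL hallF] := nilL j; first by exists p; rewrite // (piSg sXL).
exists (pi j), (F :&: X)%G; split=> //.
  exact: setI_normal_Hall nFL hallF sXL.
apply: subset_trans (subsetIl F X) _.
have tiFE : F :&: E = 1.
  apply/coprime_TIg; rewrite coprime_sym.
  apply: pnat_coprime (pHall_pgroup hallE) _.
  apply: pi'_nat (pHall_pgroup hallF) => eij.
  by rewrite eij pj in pi'p.
apply/commG1P/trivgP; rewrite -tiFE commg_subI // subsetI subxx.
  exact: subset_trans (normal_sub nFL) (normal_norm nEL).
exact: subset_trans (normal_sub nEL) (normal_norm nFL).
Qed.

Section ChiefFactor.

Variables (gT : finGroupType) (G K H : {group gT}).
Hypothesis chHK : chief_factor G K H.

Let C := 'C_G(H / K | 'Q).
Let to := chief_action chHK.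

(** The hypotheses make both factors of the semidirect product pi_i-groups, and a
    pi_i-group is its own Hall pi_i-subgroup. *)
Lemma central_chief_factor_of_pi i :
  (pi i).-group (H / K) ->
  (forall B : {group gT}, (pi i)^'.-subgroup(G) B -> B \subset 'C(H / K | 'Q)) ->
  central_chief_factor (sigma_nilpotent pi) chHK.
Proof.
move=> pHK cB; rewrite /central_chief_factor; set L := [set: sdprod_by _]%G.
have /andP[/maxgroupp/andP[_ nKG] /andP[sHG nHG]] := chHK.
have pGC : (pi i).-group (G / C).
  apply: pgroup_quotient_p'sub => [|B sB]; last first.
    by rewrite subsetI cB //; case/andP: sB => ->.
  by rewrite normsI ?normG // (subset_trans (actsQ nKG nHG)) ?astab_norm.
have pL : (pi i).-group L.
  rewrite /pgroup /= -(sdprod_card (sdprod_sdpair to)).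
  rewrite pnatM; apply/andP; split; exact: morphim_pgroup.
move=> j [p pL' pj].
have <- : i = j by apply: pi_inj pj; apply: pnatPpi pL pL'.
exists L; first exact: normal_refl.
by apply/and3P; split; rewrite ?subxx // indexgg.
Qed.

(** In the sigma-nilpotent product L = (H/K) ><| (G/C), take i such that pi_i meets
    the primes of H/K.  By minimality of H/K the normal Hall pi_i-subgroup E of L
    contains H/K; then pi_i'-subgroups of G/C centralise E, hence H/K. *)
Lemma pi_of_central_chief_factor :
  central_chief_factor (sigma_nilpotent pi) chHK ->
  exists2 i, (pi i).-group (H / K) &
    forall B : {group gT}, (pi i)^'.-subgroup(G) B -> B \subset 'C(H / K | 'Q).
Proof.
rewrite /central_chief_factor; set L := [set: sdprod_by _]%G => nilL.
have /andP[/maxgroupP[/andP[prKH nKG] maxK] /andP[sHG nHG]] := chHK.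
have nKH := subset_trans sHG nKG.
set s1 := sdpair1 to; set s2 := sdpair2 to.
have: #|H / K| != 1%N by rewrite -trivg_card1 -subG1 quotient_sub1 ?proper_subn.
rewrite neq_ltn ltnNge cardG_gt0 /= => gt1.
set p := pdiv #|H / K|.
have pHK : p \in \pi(H / K) by rewrite pi_pdiv.
have pr_p : prime p by rewrite pdiv_prime.
have [i pii] := pi_cover pr_p.
have cA : #|s1 @* (H / K)| = #|H / K| by rewrite card_injm ?injm_sdpair1.
have [|E nEL hallE] := nilL i.
  exists p => //; apply: (piSg (subsetT (s1 @* (H / K)))).
  by rewrite /= cA.
have sub_E : s1 @* (H / K) \subset E.
  (* Y is the pullback to G of the intersection of H / K with E.  It is invariant
     under G and lies between K and H, so it is K or H; since p divides #|H / K|,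
     the Hall subgroup E meets H / K nontrivially, which excludes K. *)
  pose Y := (coset K @*^-1 (s1 @*^-1 E))%G.
  have sYHK : s1 @*^-1 E \subset H / K by exact: subsetIl.
  have sYH : Y \subset H.
    rewrite /Y /=; apply: subset_trans (_ : coset K @*^-1 (H / K) \subset _).
      exact: morphpreS.
    by rewrite quotientGK // /normal proper_sub.
  have memY y : y \in H -> (y \in Y) = (s1 (coset K y) \in E).
    move=> Hy; have nKy := subsetP nKH _ Hy.
    apply/morphpreP/idP=> [[_ /morphpreP[]] // | Ey].
    by split=> //; apply/morphpreP; rewrite mem_quotient.
  have nYG : G \subset 'N(Y).
    apply/subsetP=> g Gg; rewrite inE; apply/subsetP=> _ /imsetP[y Yy ->].
    have Hy := subsetP sYH _ Yy.
    have Hyg : y ^ g \in H by rewrite memJ_norm // (subsetP nHG).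
    rewrite memY // -(chief_actionE chHK Hy Gg) /s1 sdpair_act ?mem_quotient //.
    rewrite memJ_norm; first by rewrite -memY.
    by rewrite (subsetP (normal_norm nEL)) ?inE.
  have sKY : K \subset Y by rewrite sub_cosetpre.
  have [pYH | ] := boolP (Y \proper H).
    have defY : Y :=: K by apply: maxK; rewrite // pYH.
    have := card_Hall (setI_normal_Hall nEL hallE (subsetT (s1 @* (H / K)))).
    rewrite /= cA.
    have -> : E :&: s1 @* (H / K) = 1.
      have sK1 : s1 @*^-1 E = 1.
        apply/trivgP; rewrite -(cosetpreSK (s1 @*^-1 E)%G 1%G) /= cosetpre1.
        by rewrite -[coset K @*^-1 _]/(gval Y) defY.
      apply/trivgP/subsetP=> z /setIP[Ea /morphimP[a _ Ha def_a]].
      have: a \in s1 @*^-1 E by apply/morphpreP; rewrite -def_a.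
      by rewrite sK1 def_a => /set1P->; rewrite morph1 group1.
    rewrite cards1 => /esym/eqP; rewrite partn_eq1 // => pi'HK.
    by have /negP := pnatPpi pi'HK pHK.
  rewrite properE sYH negbK => sHY; apply/subsetP=> _ /morphimP[hb _ Hhb ->].
  by case/morphimP: Hhb => h nKh Hh ->; rewrite -memY ?(subsetP sHY).
exists i => [|B].
  by rewrite /pgroup -cA; apply: pgroupS sub_E (pHall_pgroup hallE).
case/andP=> sBG pi'B.
have cXE : s2 @* (B / C) \subset 'C(E).
  apply: sigma_nilpotent_cent nilL hallE nEL _.
  by rewrite /psubgroup subsetT !morphim_pgroup.
apply/subsetP=> x Bx; have Gx := subsetP sBG _ Bx.
have nKx := subsetP nKG _ Gx.
rewrite astabQ; apply/morphpreP; split=> //.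
apply/centP=> hb /morphimP[h nKh Hh ->]; apply/esym/commgP/conjg_fixP.
have <- : coset K (h ^ x) = coset K h ^ coset K x by rewrite morphJ.
rewrite -(chief_actionE chHK Hh Gx).
apply: (injmP (injm_sdpair1 to)); rewrite ?mem_quotient //.
  by rewrite gact_stable ?mem_quotient.
rewrite /= sdpair_act ?mem_quotient //; apply/conjg_fixP/commgP.
have Eh : s1 (coset K h) \in E.
  by apply: (subsetP sub_E); rewrite mem_morphim ?mem_quotient.
have cEx : s2 (coset C x) \in 'C(E).
  by apply: (subsetP cXE); rewrite mem_morphim ?mem_quotient.
exact: commute_sym (centP cEx _ Eh).
Qed.

End ChiefFactor.

(** * Hypercentral subgroups and maximal pi_i-subgroups *)

Section HypercentralSubgroups.

Variables (gT : finGroupType) (G : {group gT}).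
Implicit Types N K H B D T E : {group gT}.

(** The quantifier over pi_i'-subgroups B encodes that G / C_G('O_(pi i)(N)) is a
    pi_i-group. *)
Definition sigma_central (N : {group gT}) := forall i,
  (pi i).-Hall(N) 'O_(pi i)(N) /\
  forall B : {group gT}, (pi i)^'.-subgroup(G) B -> B \subset 'C('O_(pi i)(N)).

(** Only the pi_i-part changes from K to N.  R = 'O_(pi i)^'(K) is a normal Hall
    pi_i'-subgroup of N, and a Schur-Zassenhaus complement T of it, being a
    pi_i-group, centralises the other parts 'O_(pi j)(K), hence R; so T is normal
    in N.  A pi_i'-element x centralises N/K and 'O_(pi i)(K), so [~ t, x] lies in
    'O_(pi i)(K) for t in T, and coprimality makes it trivial. *)
Lemma sigma_central_chief K N i :
  chief_factor G K N -> sigma_central K ->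
  (pi i).-group (N / K) ->
  (forall B : {group gT}, (pi i)^'.-subgroup(G) B -> B \subset 'C(N / K | 'Q)) ->
  sigma_central N.
Proof.
move=> chNK scK pNK cNK.
have /andP[/maxgroupp/andP[prKN nKG] nNG] := chNK.
have sNG := normal_sub nNG; have nKN := subset_trans sNG nKG.
have sKN := proper_sub prKN; have nKN' : K <| N by rewrite /normal sKN.
have pK : (pi i).-nat #|N : K| by rewrite -card_quotient.
move=> j; have [eji | nji] := pselect (j = i); last first.
  have [/and3P[_ pO p'O] cO] := scK j.
  have nON : 'O_(pi j)(K) <| N := char_normal_trans (pcore_char _ _) nKN'.
  have hallO : (pi j).-Hall(N) 'O_(pi j)(K).
    rewrite /pHall normal_sub // pO -(Lagrange_index sKN (pcore_sub _ _)) pnatM.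
    by rewrite p'O andbT (pi'_nat nji).
  by rewrite (normal_Hall_pcore hallO nON).
rewrite {j}eji; set R := 'O_(pi i)^'(K)%G.
have sOR j : j <> i -> 'O_(pi j)(K) \subset R.
  move=> nji; apply: pcore_max (pcore_normal _ _).
  by apply: pi'_nat (pcore_pgroup _ _) => //; apply/nesym.
have pR : (pi i).-nat #|K : R|.
  apply/pnatP=> // q pr_q dv_q.
  have [j qj] := pi_cover pr_q; apply/idPn=> pi'q.
  have nji : j <> i by move=> eji; rewrite eji (negPf pi'q) in qj.
  have [/and3P[_ _ p'O] _] := scK j.
  have /pnatP := pnat_dvd (indexgS K (sOR j nji)) p'O.
  by move/(_ (indexg_gt0 _ _) q pr_q dv_q); rewrite !inE qj.
have nRN : R <| N by apply: char_normal_trans nKN'; apply: pcore_char.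
have hallR : (pi i)^'.-Hall(N) R.
  rewrite /pHall normal_sub // pcore_pgroup /=.
  rewrite -(Lagrange_index sKN (pcore_sub _ _)) pnatNK pnatM pK.
  exact: pR.
have /splitsP[T complT] := SchurZassenhaus_split (pHall_Hall hallR) nRN.
have hallT : (pi i).-Hall(N) T.
  by move: complT; rewrite (compl_p'Hall _ hallR).
have /complP[_ defN] := complT.
have sTN : T \subset N by rewrite -defN mulG_subr.
have pT := pHall_pgroup hallT.
have cRT : R \subset 'C(T).
  apply: subG_Hall_cover => p pR'.
  have pr_p : prime p by move: pR'; rewrite mem_primes => /andP[].
  have [j pj] := pi_cover pr_p.
  have nji : j <> i.
    by move=> eji; have /negP := pnatPpi (pcore_pgroup _ _) pR'; rewrite -eji.
  have [hallO cO] := scK j.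
  exists (pi j), 'O_(pi j)(K)%G; split=> //.
    by apply: pHall_subl hallO; [exact: sOR | exact: pcore_sub].
  rewrite centsC cO // /psubgroup (subset_trans sTN) //=.
  exact: pi'_nat pT.
have nTN : T <| N.
  by rewrite /normal sTN -defN mulG_subG normG cents_norm.
have defT : 'O_(pi i)(N) = T by apply: normal_Hall_pcore hallT nTN.
split=> [|B sB]; first by rewrite defT.
have /andP[sBG pB] := sB.
have nTG : G \subset 'N(T).
  by rewrite -defT; apply: char_norm_trans (pcore_char _ _) (normal_norm nNG).
have [hallO cO] := scK i.
have sBNK : [~: B, N] \subset K.
  by rewrite -sub_astabQR ?cNK ?(subset_trans sBG).
rewrite defT; apply/subsetP=> x Bx; apply/centP=> t Tt.
have Gx := subsetP sBG _ Bx.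
have Oc : [~ t, x] \in 'O_(pi i)(K).
  rewrite mem_Hall_pcore //.
    apply: mem_p_elt pT _.
    by rewrite commgEl groupM ?groupV // memJ_norm // (subsetP nTG).
  by rewrite -groupV invg_comm (subsetP sBNK) // mem_commg // (subsetP sTN).
apply/commute_sym/coprime_commg_cent.
  by apply/commute_sym; apply: (centP (subsetP (cO B sB) _ Bx)).
apply: pnat_coprime (mem_p_elt (pcore_pgroup _ _) Oc) _.
exact: mem_p_elt pB Bx.
Qed.

Lemma sigma_central_of_chief N :
  N <| G ->
  (forall K H (chHK : chief_factor G K H), H \subset N ->
     central_chief_factor (sigma_nilpotent pi) chHK) ->
  sigma_central N.
Proof.
have [n] := ubnP #|N|; elim: n N => // n IHn N leN nNG cN.
have [N1 | ntN] := eqVneq (N : {set gT}) 1.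
  move=> i; have O1 : 'O_(pi i)(N) = 1 by apply/trivgP; rewrite -N1 pcore_sub.
  split=> [|B _]; last by rewrite O1 cents1.
  by rewrite O1 pHallE sub1G N1 /= cards1 partn1.
have [K maxK _] : {K : {group gT} | maxnormal K N G & 1%G \subset K}.
  by apply: maxgroup_exists; rewrite properE sub1G subG1 ntN norms1.
have chNK : chief_factor G K N by rewrite /chief_factor maxK.
have /andP[prKN nKG] := maxgroupp maxK.
have sKN := proper_sub prKN.
have [i pNK cNK] := pi_of_central_chief_factor (cN _ _ chNK (subxx _)).
apply: sigma_central_chief chNK _ pNK cNK.
apply: IHn => [||A B chAB sBK].
- by rewrite -ltnS (leq_trans _ leN) // ltnS proper_card.
- by rewrite /normal nKG (subset_trans sKN) ?normal_sub.
by apply: cN; apply: subset_trans sKN.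
Qed.

(** H contains 'O_(pi i)(N), since it contains 'O_(pi i)(G), and centralises the
    'O_(pi j)(N) with j <> i, since it is a pi_j'-group. *)
Lemma sigma_central_norm_max N H i :
  N <| G -> sigma_central N -> [max H | (pi i).-subgroup(G) H] ->
  N \subset 'N(H).
Proof.
move=> nNG scN maxH; have /andP[sHG pH] := maxgroupp maxH.
apply: subG_Hall_cover => p pN.
have pr_p : prime p by move: pN; rewrite mem_primes => /andP[].
have [j pj] := pi_cover pr_p; have [hallO cO] := scN j.
exists (pi j), 'O_(pi j)(N)%G; split=> //.
have [eji | nji] := pselect (j = i).
  apply: subset_trans (normG H); rewrite eji.
  apply: subset_trans (_ : 'O_(pi i)(G) \subset H); last first.
    by rewrite /pcore bigcap_inf.
  apply: pcore_max (pcore_pgroup _ _) _.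
  exact: char_normal_trans (pcore_char _ _) nNG.
rewrite cents_norm // centsC cO // /psubgroup sHG; exact: pi'_nat pH.
Qed.

(** The members of M meet D in normal subgroups of D, so those containing a Sylow
    subgroup for a prime of pi_i supply the Hall part, and the others centralise
    'O_(pi i)(D) because the two normalise each other and meet trivially. *)
Lemma sigma_central_of_norm_max D (M : {set {group gT}}) :
  (forall H, H \in M -> exists i, [max H | (pi i).-subgroup(G) H]) ->
  (forall P : {group gT}, Sylow G P -> exists2 H, H \in M & P \subset H) ->
  D <| G -> (forall H, H \in M -> D \subset 'N(H)) ->
  sigma_central D.
Proof.
move=> maxM sylM nDG nMD.
have sylow_M p (P : {group gT}) : p \in \pi(P) -> P \subset G -> p.-group P ->
    exists i H,
      [/\ p \in pi i, H \in M, H \subset G, (pi i).-group H & P \subset H].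
  move=> pP sPG pgP.
  have [S sylS sPS] := Sylow_superset sPG pgP.
  have [H HM sSH] := sylM S (p_Sylow sylS); have sPH := subset_trans sPS sSH.
  have [i /maxgroupp/andP[sHG pH]] := maxM H HM.
  exists i, H; split=> //; exact: pnatPpi pH (piSg sPH pP).
move=> i; have hallO : (pi i).-Hall(D) 'O_(pi i)(D).
  rewrite /pHall pcore_sub pcore_pgroup /=; apply/pnatP=> // q pr_q dv_q.
  apply/negP=> qi; have [P sylP] := Sylow_exists q D.
  have qP : q \in \pi(P).
    rewrite /= (card_Hall sylP) pi_of_part // inE /= mem_primes pr_q cardG_gt0.
    rewrite (dvdn_trans dv_q) ?dvdn_indexg //; exact: eqxx.
  have sPD := pHall_sub sylP.
  have [j [H [qj HM sHG pH sPH]]] :=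
    sylow_M q P qP (subset_trans sPD (normal_sub nDG)) (pHall_pgroup sylP).
  have eij := pi_inj qi qj; rewrite -{j}eij in pH qj.
  have sPO : P \subset 'O_(pi i)(D).
    apply: subset_trans (_ : D :&: H \subset _); first by rewrite subsetI sPD.
    apply: pcore_max; first exact: pgroupS (subsetIr _ _) pH.
    by rewrite /normal subsetIl normsI ?normG ?nMD.
  have /and3P[_ _ /pnatP q'P] := sylP.
  have := q'P (indexg_gt0 _ _) q pr_q (dvdn_trans dv_q (indexgS D sPO)).
  by rewrite !inE eqxx.
split=> // B /andP[sBG pB]; apply: subG_Hall_cover => p pB'.
have [P sylP] := Sylow_exists p B; exists p, P; split=> //; first exact: eqxx.
have sPG := subset_trans (pHall_sub sylP) sBG.
have pP : p \in \pi(P).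
  rewrite /= (card_Hall sylP) pi_of_part // inE /= pB'; exact: eqxx.
have [j [H [pj HM sHG pH sPH]]] := sylow_M p P pP sPG (pHall_pgroup sylP).
have nij : i <> j by move=> eij; have /negP := pnatPpi pB pB'; rewrite eij.
have tiHO : H :&: 'O_(pi i)(D) = 1.
  apply/coprime_TIg; rewrite coprime_sym.
  exact: pnat_coprime (pcore_pgroup _ _) (pi'_nat nij pH).
apply: subset_trans sPH _; apply/commG1P/trivgP; rewrite -tiHO commg_subI //.
  rewrite subsetI subxx (subset_trans sHG) //.
  exact: char_norm_trans (pcore_char _ _) (normal_norm nDG).
by rewrite subsetI subxx (subset_trans (pcore_sub _ _)) ?nMD.
Qed.

(** If p in pi_i divides #|H / K|, the Hall pi_i-subgroup Q = 'O_(pi i)(N) :&: H of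
    H is not inside K, so H = K Q by minimality: H / K = Q / K is a pi_i-group,
    and is centralised by all that centralises 'O_(pi i)(N). *)
Lemma hypercentral_of_sigma_central N :
  N <| G -> sigma_central N -> hypercentral (sigma_nilpotent pi) G N.
Proof.
move=> nNG scN; have [N1 | ntN] := eqVneq (N : {set gT}) 1; [by left | right].
split=> // K H chHK sHN.
have /andP[/maxgroupP[/andP[prKH nKG] maxK] /andP[sHG nHG]] := chHK.
have sKH := proper_sub prKH; have nKH := subset_trans sHG nKG.
have: #|H / K| != 1%N by rewrite -trivg_card1 -subG1 quotient_sub1 ?proper_subn.
rewrite neq_ltn ltnNge cardG_gt0 /= => gt1.
have pr_p := pdiv_prime gt1; have dv_p := pdiv_dvd #|H / K|.
set p := pdiv _ in pr_p dv_p.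
have [i pii] := pi_cover pr_p; have [hallO cO] := scN i.
set O := 'O_(pi i)(N)%G in hallO cO.
have nON : O <| N := pcore_normal _ _.
have nOG : G \subset 'N(O).
  exact: char_norm_trans (pcore_char _ _) (normal_norm nNG).
have hallQ := setI_normal_Hall nON hallO sHN; set Q := (O :&: H)%G in hallQ.
have [sQH pQ p'Q] := and3P hallQ.
have nQG : G \subset 'N(Q) by rewrite normsI.
have nKQ := subset_trans sQH nKH.
have defH : K <*> Q = H.
  apply/eqP; rewrite eqEproper join_subG sKH sQH /=; apply/negP=> prKQ.
  have sQK : Q \subset K.
    rewrite -(maxK _ _ (joing_subl K Q)) ?joing_subr //=.
    by rewrite prKQ normsY.
  have := pnat_dvd (indexgS H sQK) p'Q; rewrite -card_quotient //.
  by move/pnatP=> /(_ (cardG_gt0 _) p pr_p dv_p) /negP.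
have defHK : H / K = Q / K.
  by rewrite -defH joingC norm_joinEl // quotientMidr.
apply: (central_chief_factor_of_pi (i := i)).
  by rewrite defHK quotient_pgroup.
move=> B sB; have /andP[sBG _] := sB; rewrite defHK.
rewrite sub_astabQR ?(subset_trans sBG nKG) //.
have /commG1P-> : B \subset 'C(Q); last exact: sub1G.
by rewrite (subset_trans (cO B sB)) // centS ?subsetIl.
Qed.

End HypercentralSubgroups.

End SigmaCentral.

Theorem corollary1p1 (I : Type) (pi : I -> nat_pred)
    (gT : finGroupType) (G : {group gT}) (M : {set {group gT}}) :
  prime_partition pi ->
  (forall H : {group gT}, H \in M ->
     exists i, [max H | (pi i).-subgroup(G) H]) ->
  (forall H : {group gT}, H \in M ->
     forall x, x \in G -> (H :^ x)%G \in M) ->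
  (forall P : {group gT}, Sylow G P ->
     exists2 H : {group gT}, H \in M & P \subset H) ->
  \bigcap_(H in M) 'N_G(H) = hypercenter (sigma_nilpotent pi) G.
Proof.
move=> pi_part maxM conjM sylM.
pose D := [group of \bigcap_(H in M) 'N_G(H)]; rewrite -[LHS]/(gval D).
(* M is nonempty, which puts the intersection inside G. *)
have [H0 M_H0 _] : exists2 H : {group gT}, H \in M & 1%G \subset H.
  have [P /p_Sylow/sylM[H MH _]] := Sylow_exists 2 G.
  by exists H; rewrite ?sub1G.
have sDG : D \subset G by rewrite (bigcap_min H0) ?subsetIl.
have nDG : D <| G.
  rewrite /normal sDG; apply/subsetP=> x Gx; rewrite inE; apply/bigcapsP=> H MH.
  rewrite -(conjSg _ _ x^-1) conjsgK conjIg -normJ conjGid ?groupV //.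
  by rewrite (bigcap_inf (H :^ x^-1)%G) ?conjM ?groupV.
have nMD H : H \in M -> D \subset 'N(H).
  by move=> MH; rewrite (bigcap_min H) ?subsetIr.
apply/eqP; rewrite eqEsubset; apply/andP; split.
  apply: (@sub_prod_group _ _ _ id D); apply/asboolP; split=> //.
  apply: hypercentral_of_sigma_central => //.
  exact: sigma_central_of_norm_max maxM sylM nDG nMD.
rewrite /hypercenter; elim/big_ind: _ => [||N].
- by apply/bigcapsP=> H _; apply: sub1G.
- move=> A B; exact: mul_subG.
case/asboolP=> nNG hN; have scN : sigma_central pi G N.
  apply: sigma_central_of_chief => // K H chHK sHN.
  (* There is no chief factor below the trivial group. *)
  case: hN => [N1 | [_]]; last exact.
  have /andP[/maxgroupp/andP[/proper_subn/negP[]]] := chHK.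
  by rewrite (subset_trans sHN) // N1 sub1G.
apply/bigcapsP=> H /maxM[i maxH]; rewrite subsetI normal_sub //.
exact: sigma_central_norm_max maxH.
Qed.
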